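(* A closed set $\varnothing\neq M\subset\mathbb{R}^2$ belongs to $\mathcal{D}_2$ if and only if (i) each component of $M$ belongs to $\mathcal{D}_2$, and (ii) the system of all components of $M$ is discrete.
   Context: A function on an open convex set $C\subset\mathbb{R}^d$ is DC if it is the difference of two convex functions on $C$. $\mathcal{D}_2$ denotes the family consisting of $\varnothing$ together with all nonempty closed sets $A\subset\mathbb{R}^2$ whose distance function $d_A=\operatorname{dist}(\cdot,A)$ is DC on $\mathbb{R}^2$. A system $\mathcal{A}$ of subsets of $\mathbb{R}^2$ is discrete if each $z\in\mathbb{R}^2$ has a neighbourhood which intersects at most one member of $\mathcal{A}$. *)

(* Defs.v *)
From HB Require Import structures.
From mathcomp Require Import all_boot all_order all_algebra.
From mathcomp Require Import all_classical all_reals all_analysis.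
Set Implicit Arguments. Unset Strict Implicit. Unset Printing Implicit Defensive.
Import Order.TTheory GRing.Theory Num.Theory.
Import numFieldNormedType.Exports.
Local Open Scope classical_set_scope.
Local Open Scope ring_scope.

Definition eucl {R : realType} (z : R * R) : R :=
  Num.sqrt (z.1 ^+ 2 + z.2 ^+ 2).

Definition distA {R : realType} (A : set (R * R)) (z : R * R) : R :=
  inf [set eucl (z.1 - a.1, z.2 - a.2) | a in A].

Definition convex2 {R : realType} (f : R * R -> R) : Prop :=
  forall (x y : R * R) (t : R), 0 <= t -> t <= 1 ->
    f (t * x.1 + (1 - t) * y.1, t * x.2 + (1 - t) * y.2)
      <= t * f x + (1 - t) * f y.

Definition DC2 {R : realType} (f : R * R -> R) : Prop :=
  exists g h : R * R -> R, convex2 g /\ convex2 h /\ forall z, f z = g z - h z.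

Definition inD2 {R : realType} (A : set (R * R)) : Prop :=
  A = set0 \/ (closed A /\ A !=set0 /\ DC2 (distA A)).

Definition component_of {R : realType} (M : set (R * R)) (C : set (R * R)) : Prop :=
  exists2 x, M x & C = connected_component M x.

Definition discrete_system {R : realType} (S : set (set (R * R))) : Prop :=
  forall z : R * R, exists U : set (R * R), nbhs z U /\
    forall C1 C2, S C1 -> S C2 -> U `&` C1 !=set0 -> U `&` C2 !=set0 -> C1 = C2.

(* Main.v *)
(* Being a difference of convex functions is a local property (Hartman), and off a closed set A
   the function d_A is locally semiconcave. So whether d_A is DC depends only on the germs of A
   at its points, which settles sufficiency of (i) and (ii), and (i) once (ii) is known.

   For (ii), let d_M = g - h with g, h convex and z in M. A relatively clopen part K of M near z
   that misses z has a point p closest to z. Along the segment from z to p the function d_M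
   decreases with slope -1 near p; as d_M vanishes at z and at p, convexity of g and h yields
   |p - z| <= h(z + 2(p - z)) - 2 h(p) + h(z), while the right-hand side is o(|p - z|). Hence
   every such K near z contains z, so a neighbourhood of z in M lies in the component of z. *)

Require Import Defs.
From HB Require Import structures.
From mathcomp Require Import all_boot all_order all_algebra.
From mathcomp Require Import all_classical all_reals all_analysis.
From mathcomp Require Import ring lra.
Import Order.TTheory GRing.Theory Num.Theory.
Import numFieldNormedType.Exports.
Local Open Scope classical_set_scope.
Local Open Scope ring_scope.

(** * Local convexity and its globalization on an interval *)

Definition locally_convex_at {R : realType} {V : normedModType R} (f : V -> R) (z : V) : Prop :=
  exists2 r : R, 0 < r & forall (x y : V) (t : R), `|x - z| < r -> `|y - z| < r ->
    0 <= t -> t <= 1 -> f (t *: x + (1 - t) *: y) <= t * f x + (1 - t) * f y.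

(** The chords from [s] to [s + q] and [s - q] bound [f (s + h) - f s] above by a multiple of [|h|];
    the midpoint inequality at [s] reflects this into a lower bound. *)
Lemma locally_convex_at_continuous (R : realType) (f : R^o -> R) (s : R^o) :
  locally_convex_at f s -> {for s, continuous f}.
Proof.
move=> [r r0 fr]; pose q := r / 2; have q0 : 0 < q by rewrite divr_gt0.
pose C : R := `|f (s + q) - f s| + `|f (s - q) - f s|.
have C0 : 0 <= C by rewrite addr_ge0.
have up (h : R) : `|h| <= q -> f (s + h) - f s <= C * (`|h| / q).
  move=> hq; pose t := `|h| / q.
  have t0 : 0 <= t by rewrite divr_ge0// ltW.
  have t1 : t <= 1 by rewrite ler_pdivrMr// mul1r.
  have qE : `|h| = t * q by rewrite /t divfK// gt_eqF.
  suff [w [wq hE]] : exists w, (w = q \/ w = - q) /\ h = t * w.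
    have wC : f (s + w) - f s <= C.
      case: wq => ->; rewrite (le_trans (ler_norm _))// /C ?lerDl ?lerDr//.
    have swr : `|s + w - s| < r.
      by rewrite [s + w]addrC addrK; case: wq => ->; rewrite ?normrN gtr0_norm// /q; lra.
    have ssr : `|s - s| < r by rewrite subrr normr0.
    have := fr _ _ t swr ssr t0 t1.
    have -> : (t *: (s + w) + (1 - t) *: s : R^o) = s + h.
      by rewrite hE /GRing.scale/=; ring.
    rewrite -/t; have := ler_wpM2l t0 wC. lra.
  have [h0|h0] := leP 0 h.
    by exists q; split; [left|rewrite -qE ger0_norm].
  by exists (- q); split; [right|rewrite mulrN -qE ltr0_norm// opprK].
have mid (h : R) : `|h| <= q -> f s - f (s + h) <= f (s - h) - f s.
  move=> hq; have hr : `|h| < r by rewrite (le_lt_trans hq)// /q; lra.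
  have := fr (s + h) (s - h) 2^-1.
  have -> : ((2^-1 : R) *: (s + h) + (1 - 2^-1) *: (s - h) : R^o) = s.
    rewrite /GRing.scale/=; lra.
  rewrite ![_ - s]addrC !addKr normrN => /(_ hr hr); lra.
apply/cvgrPdist_le => /= e e0.
near=> x.
have [h xE] : exists h, x = s + h by exists (x - s); rewrite addrC subrK.
have hx : `|h| < Num.min q (e * q / (C + 1)).
  have -> : `|h| = `|s - x| by rewrite xE opprD addNKr normrN.
  near: x; apply/nbhs_ballP; exists (Num.min q (e * q / (C + 1))) => //=.
  by rewrite lt_min q0 divr_gt0// ?mulr_gt0// ltr_wpDl.
move: hx; rewrite lt_min => /andP[hq he].
have Ce : C * (`|h| / q) <= e.
  rewrite mulrA ler_pdivrMr//; move: he; rewrite ltr_pdivlMr ?ltr_wpDl// => he.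
  have := normr_ge0 h; nra.
have h1 := up _ (ltW hq).
have h2 := up (- h); rewrite normrN in h2; have {}h2 := h2 (ltW hq).
have h3 := mid _ (ltW hq).
rewrite xE ler_norml; lra.
Unshelve. all: by end_near. Qed.

(** A value above the chord would give the perturbed difference [F] a positive interior maximum,
    against the midpoint inequality there. *)
Lemma locally_convex_le_chord (R : realType) (f : R^o -> R) :
  (forall s, locally_convex_at f s) ->
  forall t, 0 <= t -> t <= 1 -> f t <= t * f 1 + (1 - t) * f 0.
Proof.
move=> fc t t0 t1; rewrite leNgt; apply/negP => ft.
pose e := f t - (t * f 1 + (1 - t) * f 0).
have e0 : 0 < e by rewrite subr_gt0.
(* The perturbation [e * (s^2 - s)] makes [F] strictly convex around an interior maximum. *)
pose F s := f s - (s * f 1 + (1 - s) * f 0) + e * (s ^+ 2 - s).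
have cF : {within `[(0:R), 1], continuous F}.
  apply: continuous_subspaceT => s.
  rewrite /F; apply: cvgD; last first.
    by apply: cvgM; [exact: cvg_cst|apply: cvgB; [exact: exprn_continuous|exact: cvg_id]].
  apply: cvgB; first exact: locally_convex_at_continuous.
  apply: cvgD; apply: cvgM; [exact: cvg_id|exact: cvg_cst| |exact: cvg_cst].
  by apply: cvgB; [exact: cvg_cst|exact: cvg_id].
have [c c01 cmax] := EVT_max ler01 cF.
have Fpos : 0 < F c.
  apply: (lt_le_trans _ (cmax t _)); last by rewrite in_itv/= t0.
  (* The perturbation costs at most [e / 4], so [F t >= 3 e / 4]. *)
  rewrite /F -/e; have : t - t ^+ 2 <= 4^-1 by have := sqr_ge0 (t - 2^-1); lra.
  by move=> ?; nra.
have F0 : F 0 = 0 by rewrite /F; ring.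
have F1 : F 1 = 0 by rewrite /F; ring.
move: c01; rewrite in_itv/= => /andP[c0 c1].
have {}c0 : 0 < c by rewrite lt_neqAle c0 andbT; apply: contraTneq Fpos => <-; rewrite F0 ltxx.
have {}c1 : c < 1 by rewrite lt_neqAle c1 andbT; apply: contraTneq Fpos => ->; rewrite F1 ltxx.
have [r r0 fr] := fc c.
pose d := Num.min (r / 2) (Num.min c (1 - c)).
have d0 : 0 < d by rewrite !lt_min divr_gt0// c0 subr_gt0.
have dr : d < r by rewrite gt_min; apply/orP; left; lra.
have dc : d <= c by rewrite !ge_min lexx orbT.
have dc1 : d <= 1 - c by rewrite !ge_min lexx !orbT.
have F1c : F (c + d) <= F c by apply: cmax; rewrite in_itv/=; apply/andP; split; lra.
have F2c : F (c - d) <= F c by apply: cmax; rewrite in_itv/=; apply/andP; split; lra.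
have := fr (c + d) (c - d) 2^-1.
have -> : ((2^-1 : R) *: (c + d) + (1 - 2^-1) *: (c - d) : R^o) = c.
  rewrite /GRing.scale/=; lra.
rewrite ![_ - c]addrC !addKr normrN gtr0_norm// => /(_ dr dr).
(* The second difference of [F] at [c] is at least [2 * e * d ^+ 2]. *)
have d20 : 0 < e * d ^+ 2 by rewrite mulr_gt0// exprn_gt0.
move: F1c F2c d20; rewrite /F !expr2; lra.
Qed.

Lemma convex_combB {R : realType} {V : lmodType R} (x y z : V) (t : R) :
  t *: x + (1 - t) *: y - z = t *: (x - z) + (1 - t) *: (y - z).
Proof.
rewrite !scalerBr addrACA -opprD -scalerDl.
by rewrite [t + _]addrC subrK scale1r.
Qed.

Lemma ball_convex {R : realType} {V : normedModType R} {x y z : V} {t r : R} :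
  `|x - z| < r -> `|y - z| < r -> 0 <= t -> t <= 1 ->
  `|t *: x + (1 - t) *: y - z| < r.
Proof.
move=> xr yr t0 t1; rewrite convex_combB (le_lt_trans (ler_normD _ _))// !normrZ.
have t1' : 0 <= 1 - t by rewrite subr_ge0.
rewrite !ger0_norm//.
have [->|tN0] := eqVneq t 0; first by rewrite mul0r add0r subr0 mul1r.
have tp : 0 < t by rewrite lt_neqAle eq_sym tN0.
have := ler_wpM2l t1' (ltW yr); have : t * `|x - z| < t * r by rewrite ltr_pM2l.
lra.
Qed.

Section locally_convex.
Context {R : realType} {V : normedModType R}.
Implicit Types (f g : V -> R) (z : V).

Lemma locally_convex_at_near f g z : (\forall x \near z, f x = g x) ->
  locally_convex_at f z -> locally_convex_at g z.
Proof.
move=> /nbhs_ballP[e e0 eq_fg] [r r0 fc]; exists (Num.min r e); first by rewrite lt_min r0.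
have eqE x : `|x - z| < e -> f x = g x by move=> xe; apply: eq_fg; rewrite -ball_normE/= distrC.
move=> x y t; rewrite !lt_min => /andP[xr xe] /andP[yr ye] t0 t1.
by rewrite -!eqE ?fc//; exact: ball_convex.
Qed.

Lemma locally_convex_atD f g z : locally_convex_at f z -> locally_convex_at g z ->
  locally_convex_at (fun x => f x + g x) z.
Proof.
move=> [r r0 fc] [e e0 gc]; exists (Num.min r e); first by rewrite lt_min r0.
move=> x y t; rewrite !lt_min => /andP[xr xe] /andP[yr ye] t0 t1.
have := fc x y t xr yr t0 t1; have := gc x y t xe ye t0 t1; lra.
Qed.

End locally_convex.

(** * Convex functions on the plane *)

Section convex2.
Context {R : realType}.
Implicit Types (f g : R * R -> R) (z : R * R).

Lemma convex2_locally_convex_at f z : convex2 f -> locally_convex_at f z.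
Proof. by move=> fc; exists 1 => // x y t _ _; exact: fc. Qed.

(** Restriction to a segment, parametrized affinely by [w], reduces this to one variable. *)
Lemma locally_convex_at_convex2 f : (forall z, locally_convex_at f z) -> convex2 f.
Proof.
move=> fc x y t t0 t1.
pose w s := s *: x + (1 - s) *: y.
suff wc : forall s : R^o, locally_convex_at (fun s : R^o => f (w s)) s.
  have w0 : w 0 = y by rewrite /w scale0r add0r subr0 scale1r.
  have w1 : w 1 = x by rewrite /w subrr scale0r addr0 scale1r.
  have : f (w t) <= t * f (w 1) + (1 - t) * f (w 0).
    exact: (locally_convex_le_chord _ _ wc).
  by rewrite w0 w1.
move=> s; have [r r0 fr] := fc (w s).
have wB a : w a - w s = (a - s) *: (x - y).
  rewrite /w opprD addrACA -!scalerBl scalerBr -scaleNr; congr (_ + _ *: _); ring.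
have wconv a b u : w (u *: (a : R^o) + (1 - u) *: (b : R^o)) = u *: w a + (1 - u) *: w b.
  rewrite /w /GRing.scale/=; congr pair => /=; rewrite /GRing.scale/=; ring.
(* Adding 1 to the Lipschitz constant of [w] keeps the radius [r / C] meaningful when [x = y]. *)
pose C := `|x - y| + 1.
have C0 : 0 < C by rewrite ltr_wpDl.
have wr a : `|a - s| < r / C -> `|w a - w s| < r.
  rewrite ltr_pdivlMr// wB normrZ; apply: le_lt_trans.
  by rewrite ler_wpM2l// /C lerDl.
exists (r / C) => [|a b u /wr ar /wr br u0 u1]; first by rewrite divr_gt0.
by rewrite wconv; exact: fr.
Qed.

Lemma convex2D f g : convex2 f -> convex2 g -> convex2 (fun x => f x + g x).
Proof.
move=> fc gc x y t t0 t1; have := fc x y t t0 t1; have := gc x y t t0 t1; lra.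
Qed.

Lemma convex2Z a f : 0 <= a -> convex2 f -> convex2 (fun x => a * f x).
Proof.
by move=> a0 fc x y t t0 t1; have := ler_wpM2l a0 (fc x y t t0 t1); lra.
Qed.

Lemma convex2_cst a : convex2 (fun _ : R * R => a).
Proof. by move=> x y t t0 t1; lra. Qed.

Lemma convex2_norm : convex2 (fun z : R * R => `|z|).
Proof.
move=> x y t t0 t1; have t1' : 0 <= 1 - t by rewrite subr_ge0.
have := ler_normD (t *: x) ((1 - t) *: y).
by rewrite !normrZ ger0_norm// (ger0_norm t1').
Qed.

Lemma convex2_max f g : convex2 f -> convex2 g -> convex2 (fun x => Num.max (f x) (g x)).
Proof.
move=> fc gc x y t t0 t1; have t1' : 0 <= 1 - t by rewrite subr_ge0.
have maxl a b : a <= Num.max a b :> R by rewrite le_max lexx.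
have maxr a b : b <= Num.max a b :> R by rewrite le_max lexx orbT.
rewrite ge_max; apply/andP; split.
  apply: (le_trans (fc _ _ _ t0 t1)).
  by rewrite lerD// ler_wpM2l.
by apply: (le_trans (gc _ _ _ t0 t1)); rewrite lerD// ler_wpM2l.
Qed.

Lemma convex2_sum n (F : nat -> R * R -> R) : (forall i, convex2 (F i)) ->
  convex2 (fun x => \sum_(i < n) F i x).
Proof.
move=> Fc; elim: n => [|n IH].
  by under [X in convex2 X]eq_fun do rewrite big_ord0; exact: convex2_cst.
under [X in convex2 X]eq_fun do rewrite big_ord_recr/=.
exact: convex2D.
Qed.

(** The norm is the maximum norm, so the ball is a square: the values at its corners bound [f]
    above, and [2 f(0) <= f(z) + f(-z)] turns this into a lower bound. *)
Lemma convex2_bounded f (r : R) : convex2 f ->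
  exists2 C, 0 <= C & forall z, `|z| <= r -> `|f z| <= C.
Proof.
move=> fc; pose S := `|f (r, r)| + `|f (r, - r)| + `|f (- r, r)| + `|f (- r, - r)|.
have SE a b : (a = r \/ a = - r) -> (b = r \/ b = - r) -> f (a, b) <= S.
  have ? := normr_ge0 (f (r, r)); have ? := normr_ge0 (f (r, - r)).
  have ? := normr_ge0 (f (- r, r)); have ? := normr_ge0 (f (- r, - r)).
  by case=> [->|->] [->|->]; rewrite (le_trans (ler_norm _))// /S; lra.
have comb a : `|a| <= r -> exists2 t, 0 <= t <= 1 & a = t * r + (1 - t) * (- r).
  rewrite ler_norml => /andP[ar1 ar2]; have [r0|r0] := leP r 0.
    by exists 0; [rewrite lexx ler01|lra].
  exists ((r + a) / (2 * r)); last by field; rewrite gt_eqF.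
  by rewrite divr_ge0 ?ler_pdivrMr ?mulr_gt0//=; lra.
have up1 a b : `|a| <= r -> (b = r \/ b = - r) -> f (a, b) <= S.
  move=> /comb[t /andP[t0 t1] aE] br.
  have := fc (r, b) (- r, b) t t0 t1; rewrite /= -aE.
  have -> : t * b + (1 - t) * b = b by ring.
  move/le_trans; apply; have t1' : 0 <= 1 - t by rewrite subr_ge0.
  have := ler_wpM2l t0 (SE r b (or_introl erefl) br).
  by have := ler_wpM2l t1' (SE (- r) b (or_intror erefl) br); lra.
have up z : `|z| <= r -> f z <= S.
  case: z => a b; rewrite [`|_|]/(Num.max `|a| `|b|) ge_max => /andP[ar /comb[t /andP[t0 t1] bE]].
  have := fc (a, r) (a, - r) t t0 t1; rewrite /= -bE.
  have -> : t * a + (1 - t) * a = a by ring.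
  move/le_trans; apply; have t1' : 0 <= 1 - t by rewrite subr_ge0.
  have := ler_wpM2l t0 (up1 a r ar (or_introl erefl)).
  by have := ler_wpM2l t1' (up1 a (- r) ar (or_intror erefl)); lra.
exists (S + 2 * `|f 0|) => [|z zr].
  by rewrite addr_ge0 ?mulr_ge0// /S !addr_ge0.
have := up (- z); rewrite normrN => /(_ zr) Nz.
have h0 : 0 <= 2^-1 :> R by []. have h1 : 2^-1 <= 1 :> R by lra.
have := fc z (- z) 2^-1 h0 h1.
have -> : (2^-1 * z.1 + (1 - 2^-1) * (- z).1, 2^-1 * z.2 + (1 - 2^-1) * (- z).2) = 0 :> R * R.
  by congr pair => /=; lra.
have := up z zr; have := ler_norm (f 0); have := ler_norm (- f 0); rewrite normrN.
rewrite ler_norml; lra.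
Qed.

(** Prolonging the segment from [y] to [x] by unit length gives a point [w] of the ball of radius
    [r + 1], where [f] is bounded; convexity between [y] and [w] then bounds the slope. *)
Lemma convex2_lipschitz f (r : R) : convex2 f ->
  exists2 L, 0 <= L & forall x y, `|x| <= r -> `|y| <= r -> `|f x - f y| <= L * `|x - y|.
Proof.
move=> fc; have [C C0 fC] := convex2_bounded f (r + 1) fc.
exists (2 * C) => [|x y]; first by rewrite mulr_ge0.
wlog: x y / f y <= f x.
  move=> W xr yr; have [le|/ltW le] := leP (f y) (f x); first exact: W.
  by rewrite distrC [`|x - y|]distrC; exact: W.
move=> fyx xr yr; rewrite ger0_norm ?subr_ge0//.
pose d := `|x - y|; have [d0|dN0] := eqVneq d 0.
  by move/eqP: d0; rewrite normr_eq0 subr_eq0 => /eqP ->; rewrite !subrr normr0 mulr0.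
have dp : 0 < d by rewrite lt_neqAle eq_sym dN0 normr_ge0.
have dge0 : 0 <= d by exact: ltW.
pose w := x + d^-1 *: (x - y).
have wr : `|w| <= r + 1.
  rewrite (le_trans (ler_normD _ _))// lerD// normrZ ger0_norm ?invr_ge0//.
  by rewrite -/d mulVf.
have t0 : 0 <= d / (1 + d) by rewrite divr_ge0//; lra.
have d1 : 0 < 1 + d by lra.
have t1 : d / (1 + d) <= 1 by rewrite ler_pdivrMr//; lra.
have := fc w y _ t0 t1.
have -> : (d / (1 + d) * w.1 + (1 - d / (1 + d)) * y.1,
           d / (1 + d) * w.2 + (1 - d / (1 + d)) * y.2) = x.
  rewrite [RHS]surjective_pairing /w/= /GRing.scale/=; congr pair; field; rewrite dN0 gt_eqF//.
have := fC w wr; have := fC y; rewrite (le_trans yr) ?lerDl// => /(_ isT).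
rewrite !ler_norml => /andP[a1 a2] /andP[b1 b2] fx.
have td : d / (1 + d) <= d by rewrite ler_pdivrMr//; nra.
rewrite -/d; have h : f w - f y <= 2 * C by lra.
have := ler_wpM2l t0 h; have CC : 0 <= 2 * C by lra.
have := ler_wpM2r CC td; lra.
Qed.

End convex2.

(** * Gluing local DC decompositions *)

Section hartman.
Context {R : realType}.
Implicit Types (f g h k : R * R -> R) (z : R * R).

(** With such a control function [k], [f] is half the difference of [k + f] and [k - f]. Working
    with one function instead of a pair lets the data of different points be added. *)
Definition controls f k z :=
  locally_convex_at (fun x => k x + f x) z /\ locally_convex_at (fun x => k x - f x) z.

Lemma controls_near f k1 k2 z : (\forall x \near z, k1 x = k2 x) ->
  controls f k1 z -> controls f k2 z.
Proof.
move=> k12 [kD kB]; split; [apply: locally_convex_at_near kD|apply: locally_convex_at_near kB];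
  by apply: filterS k12 => x ->.
Qed.

Lemma controlsD f k1 k2 z : controls f k1 z -> convex2 k2 ->
  controls f (fun x => k1 x + k2 x) z.
Proof.
move=> [kD kB] /(@convex2_locally_convex_at _ _ z) kc; split.
  apply: locally_convex_at_near (locally_convex_atD _ _ _ kD kc).
  by near=> x; rewrite addrAC.
apply: locally_convex_at_near (locally_convex_atD _ _ _ kB kc).
by near=> x; rewrite addrAC.
Unshelve. all: by end_near. Qed.

(** Only the identity is local: [g] and [h] are convex on the whole plane, so no convex function has
    to be extended from a ball. *)
Definition locally_DC f := forall z, exists g h,
  [/\ convex2 g, convex2 h & \forall x \near z, f x = g x - h x].

Lemma ball_compact (r : R) : compact [set z : R * R | `|z| <= r].
Proof.
have := compact_setX (@segment_compact R (- r) r) (@segment_compact R (- r) r).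
congr compact; apply/seteqP; split => -[a b]; rewrite /= !in_itv/= -!ler_norml.
  by move=> [ar br]; rewrite [`|_|]/(Num.max `|a| `|b|) ge_max ar.
by rewrite [`|_|]/(Num.max `|a| `|b|) ge_max => /andP[].
Qed.

(* Adding a convex function to a control function gives a control function, so the control
   functions of a finite subcover may simply be summed; the filter below packages this. *)
Lemma ball_control f (r : R) : locally_DC f ->
  exists2 k, convex2 k & forall z, `|z| <= r -> controls f k z.
Proof.
move=> fDC; pose F := filter_from convex2
  (fun k0 => [set k | exists2 k', convex2 k' & k = (fun x => k0 x + k' x)]).
have FF : Filter F.
  apply: filter_from_filter; first by exists (fun=> 0); exact: convex2_cst.
  move=> k1 k2 c1 c2; exists (fun x => k1 x + k2 x); first exact: convex2D.
  move=> _ [k ck ->]; split.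
    by exists (fun x => k2 x + k x); [exact: convex2D|apply/funext => x; rewrite addrA].
  exists (fun x => k1 x + k x); first exact: convex2D.
  by apply/funext => x; rewrite addrA (addrC (k1 x)).
have /compact_near_coveringP/(_ _ F (controls f) FF)[] := ball_compact r.
  move=> z _; have [g [h [cg ch fgh]]] := fDC z.
  (* Near [z], [(g + h) + f = 2 g] and [(g + h) - f = 2 h], so [g + h] is a control function. *)
  exists ([set x | \forall y \near x, f y = g y - h y],
          [set k | exists2 k', convex2 k' & k = (fun x => (g x + h x) + k' x)]) => /=.
    split; first exact: nbhs_interior fgh.
    by exists (fun x => g x + h x) => //; exact: convex2D.
  move=> [x k] /= [fx [k' ck' ->]]; apply: controlsD => //; split.
    apply: (@locally_convex_at_near _ _ (fun x => 2 * g x)).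
      by apply: filterS fx => y ->; ring.
    by apply: convex2_locally_convex_at; exact: convex2Z.
  apply: (@locally_convex_at_near _ _ (fun x => 2 * h x)).
    by apply: filterS fx => y ->; ring.
  by apply: convex2_locally_convex_at; exact: convex2Z.
move=> k ck kr; exists (fun x => k x + 0).
  by apply: convex2D => //; exact: convex2_cst.
by apply: kr; exists (fun=> 0) => //; exact: convex2_cst.
Unshelve. all: by end_near. Qed.

(** Vanishing on the inner ball makes the sum over [n] locally finite, and the shells cover the
    plane. The gap from [n - 1] to [n - 1/2] leaves room for the cutoff. *)
Lemma shell_control f n : locally_DC f ->
  exists k, [/\ convex2 k, forall z, `|z| <= n%:R - 1 -> k z = 0 &
    forall z, n%:R - 2^-1 < `|z| -> `|z| < n%:R + 1 -> controls f k z].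
Proof.
move=> fDC; have [k ck kf] := ball_control f (n%:R + 1) fDC.
have [C C0 kC] := convex2_bounded k (n%:R + 1) ck.
(* The cone [D (|z| - (n - 1)) - C] pushes [k] below 0 inside the shell, above 0 on it. *)
pose D := 4 * C + 1.
pose l z := k z + (D * `|z| + (- D * (n%:R - 1) - C)).
have cl : convex2 l.
  apply: convex2D => //; apply: convex2D; last exact: convex2_cst.
  by apply: convex2Z; [rewrite /D; lra|exact: convex2_norm].
exists (fun z => Num.max 0 (l z)); split.
- by apply: convex2_max => //; exact: convex2_cst.
- move=> z zn; apply/max_idPl; rewrite /l.
  have := kC z; rewrite (le_trans zn) ?lerD2l; last by lra.
  move=> /(_ isT); rewrite ler_norml => /andP[_ kz].
  have D0 : 0 <= D by rewrite /D; lra.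
  have := ler_wpM2l D0 zn; lra.
- move=> z zn zn1; apply: (@controls_near _ l); last first.
    apply: controlsD; first exact/kf/ltW.
    apply: convex2D; last exact: convex2_cst.
    by apply: convex2Z; [rewrite /D; lra|exact: convex2_norm].
  near=> x; apply/esym/max_idPr; rewrite /l.
  have xn : n%:R - 2^-1 < `|x|.
    by near: x; apply: (cvgr_gt `|z|) => //; exact: norm_continuous.
  have xn1 : `|x| < n%:R + 1.
    by near: x; apply: (cvgr_lt `|z|) => //; exact: norm_continuous.
  have := kC x (ltW xn1); rewrite ler_norml => /andP[kx _].
  have D0 : 0 < D by rewrite /D; lra.
  have : D * (n%:R - 2^-1) < D * `|x| by rewrite ltr_pM2l.
  rewrite /D; lra.
Unshelve. all: by end_near. Qed.

(* Hartman's theorem. *)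
Lemma locally_DC_DC2 f : locally_DC f -> DC2 f.
Proof.
move=> fDC.
have /choice[k kP] : forall n, exists k, _ := fun n => shell_control f n fDC.
have kc n : convex2 (k n) by have [] := kP n.
pose S N z := \sum_(i < N) k i z.
have SE M N z : `|z| <= M%:R - 1 -> `|z| <= N%:R - 1 -> S M z = S N z.
  wlog MN : M N / (M <= N)%N.
    by move=> W zM zN; have [|/ltnW] := leqP M N => MN; [|apply/esym]; exact: W.
  move=> zM _; rewrite -(subnKC MN); elim: (N - M)%N => [|j IH]; first by rewrite addn0.
  rewrite addnS {2}/S big_ord_recr/= -/(S _ z).
  have [_ -> //] := kP (M + j)%N; first by rewrite addr0 => _; exact: IH.
  by rewrite (le_trans zM)// lerB// ler_nat leq_addr.
have trunc_bounds z : (Num.trunc `|z|)%:R <= `|z| < (Num.trunc `|z|).+1%:R.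
  by rewrite truncn_itv.
(* [|z| <= N - 1] holds from [N = trunc |z| + 2] on, and all later terms vanish at [z]: [K] is the
   full sum. *)
pose K z := S (Num.trunc `|z|).+2 z.
have KS N z : `|z| <= N%:R - 1 -> K z = S N z.
  by apply: SE; have /andP[_ /ltW] := trunc_bounds z; rewrite -[_.+2]addn1 natrD addrK.
have Kf z : controls f K z.
  have /andP[z1 z2] := trunc_bounds z; set n := Num.trunc _ in z1 z2.
  (* With [n.+3] terms the sum agrees with [K] on all of [|x| < n + 2], a neighbourhood of [z]. *)
  apply: (@controls_near _ (S n.+3)).
    near=> x; apply/esym/KS.
    have : `|x| < n.+2%:R.
      near: x; apply: (cvgr_lt `|z|); first exact: norm_continuous.
      by rewrite (lt_le_trans z2)// ler_nat.
    by move/ltW; rewrite -[n.+3]addn1 natrD addrK.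
  (* The summand [k n] controls [f] at [z] because [n <= |z| < n + 1]; the other summands are convex
     and preserve this. *)
  have Sn : controls f (S n.+1) z.
    have [_ _ /(_ z)] := kP n.
    have -> : n%:R - 2^-1 < `|z| by lra.
    rewrite -[n.+1]addn1 natrD in z2; rewrite z2 => /(_ isT isT) kz.
    apply: controls_near (controlsD _ _ _ _ kz (convex2_sum n k kc)).
    by near=> x; rewrite /S big_ord_recr/= addrC.
  have SD m : controls f (S m) z -> controls f (S m.+1) z.
    move=> Sm; apply: controls_near (controlsD _ _ _ _ Sm (kc m)).
    by near=> x; rewrite /S big_ord_recr.
  by do 2 apply: (SD).
exists (fun x => 2^-1 * (K x + f x)), (fun x => 2^-1 * (K x - f x)); split.
  by apply: convex2Z => //; apply: locally_convex_at_convex2 => z; exact: (Kf z).1.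
split; last by move=> z; lra.
by apply: convex2Z => //; apply: locally_convex_at_convex2 => z; exact: (Kf z).2.
Unshelve. all: by end_near. Qed.

End hartman.

(** * Euclidean distance functions *)

Section distance.
Context {R : realType}.
Implicit Types (A B : set (R * R)) (x y z a : R * R).

Lemma eucl_ge0 z : 0 <= eucl z.
Proof. exact: sqrtr_ge0. Qed.

Lemma sqr_eucl z : eucl z ^+ 2 = z.1 ^+ 2 + z.2 ^+ 2.
Proof. by rewrite sqr_sqrtr// addr_ge0// sqr_ge0. Qed.

Lemma eucl0 : eucl (0 : R * R) = 0.
Proof. by rewrite /eucl/= !expr0n/= addr0 sqrtr0. Qed.

Lemma eucl_scale (t : R) z : eucl (t *: z) = `|t| * eucl z.
Proof. by rewrite /eucl/= /GRing.scale/= !exprMn -mulrDr sqrtrM ?sqr_ge0// sqrtr_sqr. Qed.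

Lemma euclN z : eucl (- z) = eucl z.
Proof. by rewrite /eucl/= !sqrrN. Qed.

Lemma euclB x y : eucl (x - y) = eucl (y - x).
Proof. by rewrite -euclN opprB. Qed.

Lemma eucl_leD x y : eucl (x + y) <= eucl x + eucl y.
Proof.
rewrite -(@ler_pXn2r _ 2%N)// ?nnegrE ?addr_ge0 ?eucl_ge0// sqrrD !sqr_eucl/=.
suff : x.1 * y.1 + x.2 * y.2 <= eucl x * eucl y by lra.
rewrite (le_trans (ler_norm _))// -(@ler_pXn2r _ 2%N)// ?nnegrE ?mulr_ge0 ?eucl_ge0//.
rewrite -normrX ger0_norm ?sqr_ge0// exprMn !sqr_eucl.
have := sqr_ge0 (x.1 * y.2 - x.2 * y.1); lra.
Qed.

Lemma norm_le_eucl z : `|z| <= eucl z.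
Proof.
rewrite [`|z|]/(Num.max `|z.1| `|z.2|) ge_max -!sqrtr_sqr.
by rewrite !ler_wsqrtr// ?lerDl ?lerDr sqr_ge0.
Qed.

Lemma eucl_le_norm z : eucl z <= 2 * `|z|.
Proof.
have [h1 h2] : `|z.1| <= `|z| /\ `|z.2| <= `|z|.
  by rewrite [`|z|]/(Num.max `|z.1| `|z.2|) !le_max !lexx orbT.
rewrite -(@ler_pXn2r _ 2%N)// ?nnegrE ?mulr_ge0 ?eucl_ge0// sqr_eucl.
have := normr_ge0 z.1; have := normr_ge0 z.2.
rewrite -(real_normK (num_real z.1)) -(real_normK (num_real z.2)); nra.
Qed.

Lemma distA_le A z a : A a -> distA A z <= eucl (z - a).
Proof.
move=> Aa; apply: ge_inf; last by exists a.
by exists 0 => _ [b _ <-]; exact: eucl_ge0.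
Qed.

Lemma distA_ge A z (c : R) : A !=set0 -> (forall a, A a -> c <= eucl (z - a)) -> c <= distA A z.
Proof.
move=> [a Aa] Ac; apply: lb_le_inf; first by exists (eucl (z - a)), a.
by move=> _ [b Ab <-]; exact: Ac.
Qed.

Lemma distA_adherent A z (e : R) : A !=set0 -> 0 < e ->
  exists2 a, A a & eucl (z - a) < distA A z + e.
Proof.
move=> A0 e0; apply: contrapT => /forall2NP Ae.
suff : distA A z + e <= distA A z by lra.
by apply: distA_ge => // a Aa; have [//|/negP] := Ae a; rewrite -leNgt.
Qed.

Lemma distA_ge0 A z : A !=set0 -> 0 <= distA A z.
Proof. by move=> A0; apply: distA_ge => // a _; exact: eucl_ge0. Qed.

Lemma distA_mem A z : A z -> distA A z = 0.
Proof.
move=> Az; apply/eqP; rewrite eq_le distA_ge0 ?andbT; last by exists z.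
by rewrite (le_trans (distA_le _ _ _ Az))// subrr eucl0.
Qed.

Lemma distA_lipschitz A x y : A !=set0 -> distA A x <= distA A y + eucl (x - y).
Proof.
move=> A0; rewrite -lerBlDr; apply: distA_ge => // a Aa; rewrite lerBlDr.
rewrite (le_trans (distA_le _ _ _ Aa))//.
by have := eucl_leD (y - a) (x - y); rewrite addrC addrA subrK.
Qed.

Lemma distA_gt0 A z : closed A -> A !=set0 -> ~ A z -> 0 < distA A z.
Proof.
move=> cA A0 Az.
have /nbhs_ballP[e /= e0 eA] : nbhs z (~` A).
  by apply: open_nbhs_nbhs; split => //; exact: closed_openC.
apply: (lt_le_trans e0); apply: distA_ge => // a Aa.
rewrite leNgt; apply/negP => ae; apply: (eA a) => //.
by rewrite -ball_normE/= (le_lt_trans (norm_le_eucl _)).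
Qed.

(** Since [z] itself competes, only points no farther from [x] than [z] matter. For
    [|z - x| < e / 4] these lie in [ball z e], as [eucl] is at most twice the norm. *)
Lemma distA_near_eq A B z : A z -> B z -> (\forall x \near z, A x <-> B x) ->
  \forall x \near z, distA A x = distA B x.
Proof.
move=> Az Bz /nbhs_ballP[e /= e0 AB].
have le A' B' : A' z -> B' z -> (forall x, ball z e x -> A' x -> B' x) ->
    forall x, `|z - x| < e / 4 -> distA B' x <= distA A' x.
  move=> A'z B'z A'B' x xz; apply: distA_ge; first by exists z.
  move=> a A'a; have [xa|ax] := leP (eucl (x - z)) (eucl (x - a)).
    exact: (le_trans (distA_le _ _ _ B'z)).
  apply: distA_le; apply: A'B' => //; rewrite -ball_normE/=.
  have := norm_le_eucl (x - a); have := eucl_le_norm (x - z).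
  have := ler_normD (z - x) (x - a); rewrite addrA subrK [`|x - z|]distrC; lra.
apply/nbhs_ballP; exists (e / 4); first by rewrite /= divr_gt0.
move=> x; rewrite -ball_normE/= => xz; apply/eqP; rewrite eq_le.
by rewrite !le//= => y /AB[].
Qed.

(* [fun x => min_(s >= c) (d_A(x)^2 / s + s) / 2], which is [d_A] where [c <= d_A]. Each
   [(|x - a|^2 / s + s) / 2] with [c <= s] differs from [|x|^2 / (2 c)] by a concave function. *)
Definition smooth_dist A (c : R) x :=
  let s := Num.max c (distA A x) in (distA A x ^+ 2 / s + s) / 2.

Lemma smooth_dist_convex A (c : R) : A !=set0 -> 0 < c ->
  convex2 (fun x => (x.1 ^+ 2 + x.2 ^+ 2) / (2 * c) - smooth_dist A c x).
Proof.
move=> A0 c0.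
(* For [s >= c], the expression [d^2 / s + s] is least at [s = max c d]. *)
have le_s (s : R) a x : A a -> c <= s -> smooth_dist A c x <= (eucl (x - a) ^+ 2 / s + s) / 2.
  move=> Aa cs; rewrite /smooth_dist ler_pM2r ?invr_gt0//.
  have s0 : 0 < s by exact: lt_le_trans cs.
  set d := distA A x; have d0 : 0 <= d by exact: distA_ge0.
  have ds : d ^+ 2 / s <= eucl (x - a) ^+ 2 / s.
    by rewrite ler_pM2r ?invr_gt0// ler_pXn2r ?nnegrE ?eucl_ge0//; exact: distA_le.
  apply: (@le_trans _ _ (d ^+ 2 / s + s)); last by rewrite lerD2r.
  rewrite -subr_ge0; have [cd|dc] := leP c d.
    have dp : 0 < d by exact: lt_le_trans cd.
    have -> : d ^+ 2 / s + s - (d ^+ 2 / d + d) = (s - d) ^+ 2 / s.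
      by field; rewrite !gt_eqF.
    by rewrite divr_ge0 ?sqr_ge0// ltW.
  have -> : d ^+ 2 / s + s - (d ^+ 2 / c + c) = (s - c) * (c * s - d ^+ 2) / (s * c).
    by field; rewrite !gt_eqF.
  have ? : d ^+ 2 <= c * s by rewrite expr2 ler_pM// ?(le_trans _ cs)// ltW.
  by rewrite divr_ge0 ?mulr_ge0 ?subr_ge0// ltW.
move=> x y t t0 t1.
set w := (X in _ - smooth_dist _ _ X <= _).
pose s := Num.max c (distA A w); have cs : c <= s by rewrite le_max lexx.
have s0 : 0 < s by exact: lt_le_trans cs.
apply/ler_addgt0Pr => e e0.
have [a Aa wa] : exists2 a, A a & eucl (w - a) ^+ 2 <= distA A w ^+ 2 + 2 * s * e.
  pose d := distA A w; have d0 : 0 <= d by exact: distA_ge0.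
  (* As [q <= 1], [(d + q)^2 <= d^2 + (2 d + 1) q]; the resulting error [2 s e] becomes [e] after
     division by [2 s]. *)
  pose q := Num.min 1 (2 * s * e / (2 * d + 1)).
  have d10 : 0 < 2 * d + 1 by lra.
  have q0 : 0 < q by rewrite lt_min ltr01 divr_gt0// !mulr_gt0.
  have [a Aa wa] := distA_adherent A w q A0 q0; exists a => //.
  apply: (@le_trans _ _ ((d + q) ^+ 2)).
    by rewrite ler_pXn2r ?nnegrE ?eucl_ge0 ?addr_ge0// ltW.
  have q1 : q <= 1 by rewrite ge_min lexx.
  have : q <= 2 * s * e / (2 * d + 1) by rewrite ge_min lexx orbT.
  rewrite ler_pdivlMr// -/d => ?; nra.
have hx := le_s s a x Aa cs; have hy := le_s s a y Aa cs.
have t1' : 0 <= 1 - t by rewrite subr_ge0.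
have {}hx := ler_wpM2l t0 hx; have {}hy := ler_wpM2l t1' hy.
have hw : (eucl (w - a) ^+ 2 / s + s) / 2 - e <= smooth_dist A c w.
  rewrite /smooth_dist -/s.
  have : eucl (w - a) ^+ 2 / s <= (distA A w ^+ 2 + 2 * s * e) / s by rewrite ler_pM2r ?invr_gt0.
  have -> : (distA A w ^+ 2 + 2 * s * e) / s = distA A w ^+ 2 / s + 2 * e by field; rewrite gt_eqF.
  lra.
rewrite -/(smooth_dist _ _ _).
have cs' : 0 <= c^-1 - s^-1 by rewrite subr_ge0 lef_pV2.
move: hx hy hw; rewrite !sqr_eucl /= !invfM.
set I := s^-1 in cs' *; set J := c^-1 in cs' *.
(* These are the convexity defects of [(1/c - 1/s) |x|^2], one coordinate at a time. *)
have := mulr_ge0 (mulr_ge0 (mulr_ge0 t0 t1') cs') (sqr_ge0 (x.1 - y.1)).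
have := mulr_ge0 (mulr_ge0 (mulr_ge0 t0 t1') cs') (sqr_ge0 (x.2 - y.2)).
lra.
Qed.

Lemma smooth_dist_eq A (c : R) x : 0 < c -> c <= distA A x -> smooth_dist A c x = distA A x.
Proof.
move=> c0 cd; rewrite /smooth_dist (max_idPr cd).
by field; rewrite gt_eqF// (lt_le_trans c0).
Qed.

Lemma convex2_sqr_norm : convex2 (fun x : R * R => x.1 ^+ 2 + x.2 ^+ 2).
Proof.
move=> x y t t0 t1 /=; have t1' : 0 <= 1 - t by rewrite subr_ge0.
have := mulr_ge0 (mulr_ge0 t0 t1') (sqr_ge0 (x.1 - y.1)).
have := mulr_ge0 (mulr_ge0 t0 t1') (sqr_ge0 (x.2 - y.2)); lra.
Qed.

(** By Hartman's theorem a decomposition near each point suffices: on [A] it is that of [distA B],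
    off [A] the distance is locally a quadratic minus a convex function. *)
Lemma DC2_distA_local A : closed A -> A !=set0 ->
  (forall z, A z -> exists B, [/\ B z, DC2 (distA B) & \forall x \near z, A x <-> B x]) ->
  DC2 (distA A).
Proof.
move=> cA A0 AB; apply: locally_DC_DC2 => z; have [Az|Az] := pselect (A z).
  have [B [Bz [g [h [cg [ch fgh]]]] near_AB]] := AB z Az.
  exists g, h; split => //; have := distA_near_eq A B z Az Bz near_AB.
  by apply: filterS => x ->.
pose c := distA A z / 2; have dz := distA_gt0 A z cA A0 Az.
have c0 : 0 < c by rewrite divr_gt0.
exists (fun x => (2 * c)^-1 * (x.1 ^+ 2 + x.2 ^+ 2)),
  (fun x => (x.1 ^+ 2 + x.2 ^+ 2) / (2 * c) - smooth_dist A c x); split.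
- by apply: convex2Z; [rewrite invr_ge0; lra|exact: convex2_sqr_norm].
- exact: smooth_dist_convex.
(* Within norm [c / 2] the Euclidean distance to [z] is below [c], so [distA A] stays above
   [2 c - c]. *)
- apply/nbhs_ballP; exists (c / 2); first by rewrite /= divr_gt0.
  move=> x; rewrite -ball_normE/= => xz; rewrite mulrC subKr smooth_dist_eq//.
  have := distA_lipschitz A z x A0; have := eucl_le_norm (z - x).
  have : distA A z = 2 * c by rewrite /c; lra.
  lra.
Qed.

End distance.

(** * Components of compact sets *)

(* [y] lies in the quasi-component of [x]; in a compact set this is the component. *)
Lemma connected_component_clopen {R : realType} {T : pseudoMetricType R} (K : set T) (x y : T) :
  closed K -> compact K -> K x ->
  (forall A, A `<=` K -> closed A -> closed (K `\` A) -> A x -> A y) ->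
  connected_component K x y.
Proof.
move=> clK cK Kx xy.
pose C := [set A | [/\ A `<=` K, closed A, closed (K `\` A) & A x]].
pose Q := \bigcap_(A in C) A.
have CK : C K by split => //; rewrite setDv; exact: closed0.
have CI A B : C A -> C B -> C (A `&` B).
  move=> [AK cA cKA Ax] [BK cB cKB Bx]; split; [by move=> z [/AK]|exact: closedI| |by []].
  by rewrite setDIr; exact: closedU.
have QK : Q `<=` K by move=> z; apply.
have Qx : Q x by move=> A [].
suff Qc : connected Q.
  by exists Q; [split|move=> A [AK cA cKA Ax]; exact: xy].
apply/connectedP => E [E0 QE [sE1 sE2]].
wlog Ex : E E0 QE sE1 sE2 / E false x.
  move=> W; have := Qx; rewrite QE => -[Ex|Ex]; first exact: (W E).
  by apply: (W (E \o negb)) => //=; rewrite 1?setUC// setIC.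
have cQ : closed Q by apply: closed_bigI => A [].
have clE b : closed (E b).
  rewrite closure_id; apply/seteqP; split; first exact: subset_closure.
  have EQ : E b `<=` Q by rewrite QE; case: b => z; [right|left].
  move=> z Ebz; have : Q z by apply: cQ; exact: closureS Ebz.
  rewrite QE; case: b Ebz {EQ} => Ebz [Ez|Ez] //.
    by suff : (set0 : set T) z by []; rewrite -sE2.
  by suff : (set0 : set T) z by []; rewrite -sE1.
have [|U [V [oU oV EU EV UV]]] :=
  (@normal_openP R T).1 pseudometric_normal _ _ (clE false) (clE true).
  by apply/seteqP; split => // z [Ez Ez']; rewrite -sE1; split => //; exact: subset_closure.
(* Along this filter of shrinking clopen pieces, compactness of [K] minus [U] and [V] yields one
   piece contained in [U] or [V] pointwise. *)
pose F := filter_from C (fun A => [set B | B `<=` A]).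
have FF : Filter F.
  apply: filter_from_filter; first by exists K.
  by move=> A B CA CB; exists (A `&` B); [exact: CI|move=> D DAB; split => z /DAB[]].
have /compact_near_coveringP/(_ _ F (fun A z => ~ A z) FF)[] : compact (K `\` (U `|` V)).
  by apply: compact_closedI => //; apply: open_closedC; exact: openU.
  move=> z [Kz UVz]; have /existsNP[A /not_implyP[CA Az]] : ~ Q z.
    by rewrite QE => -[/EU Uz|/EV Vz]; apply: UVz; [left|right].
  exists (~` A, [set B | B `<=` A]) => /=.
    split; last by exists A.
    by case: CA => _ cA _ _; apply: open_nbhs_nbhs; split => //; exact: closed_openC.
  by move=> [w B] /= [Aw BA] /BA.
move=> A CA /(_ A) AUV.
have {}AUV z : A z -> U z \/ V z.
  move=> Az; apply: contrapT => UVz; apply: (AUV _ z) => //; split => //.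
  by case: CA => + _ _ _; apply.
(* This clopen piece contains [Q], so it leaves no place for [E true], which lies in [V]. *)
have CAU : C (A `&` U).
  case: (CA) => AK cA cKA Ax; split; [by move=> z [/AK]| | |by split => //; exact: EU].
    have -> : A `&` U = A `&` ~` V; last by apply: closedI => //; exact: open_closedC.
    apply/seteqP; split => z [Az]; split => //.
      by move=> Vz; suff : (U `&` V) z by rewrite UV.
    by have [] := AUV z Az.
  by rewrite setDIr; apply: closedU => //; apply: closedI => //; exact: open_closedC.
have [z Ez] := E0 true.
have [_ Uz] : (A `&` U) z by have : Q z; [rewrite QE; right|apply].
by suff : (U `&` V) z; [rewrite UV|split => //; exact: EV].
Qed.

(** * Near a point of [M], only its own component *)

Section isolation.
Context {R : realType}.
Implicit Types (z p w : R * R).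

Lemma sphere_compact : compact [set u : R * R | `|u| = 1].
Proof.
apply: subclosed_compact (ball_compact 1) _; last by move=> u /= ->.
apply: (@preimage_closed _ _ _ [set (1 : R)]); last exact: closed_eq.
by move=> u _; exact: norm_continuous.
Qed.

(* The second difference is [o(|p|)] because the difference quotients of a convex function
   decrease to a directional derivative, uniformly in the direction by compactness. *)
Lemma convex2_second_difference (h : R * R -> R) z : convex2 h ->
  exists2 r : R, 0 < r & forall p, 0 < `|p| -> `|p| < r ->
    h (z + 2 *: p) - 2 * h (z + p) + h z < `|p|.
Proof.
move=> ch; have [L L0 hL] := convex2_lipschitz h (`|z| + 2) ch.
pose P (t : R) u := h (z + (2 * t) *: u) - 2 * h (z + t *: u) + h z < t.
have /compact_near_coveringP/(_ R (0^'+) P _)[] := sphere_compact.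
- move=> u /= u1.
  have zu t v : 0 <= t -> t <= 1 -> `|v| <= 2 -> `|z + t *: v| <= `|z| + 2.
    move=> t0 t1 v2; rewrite (le_trans (ler_normD _ _))// lerD2l normrZ ger0_norm//.
    have := normr_ge0 v; nra.
  pose q t := (h (z + t *: u) - h z) / t.
  pose S := [set q t | t in [set t | 0 < t <= 1]].
  have S0 : S !=set0 by exists (q 1), 1 => //=; rewrite ltr01 lexx.
  have Sinf : has_inf S.
    split => //; exists (- L) => _ [t /= /andP[t0 t1] <-].
    have := hL (z + t *: u) z; rewrite zu ?(ltW t0)// ?u1 ?ler1n// lerDl ler0n => /(_ isT isT).
    rewrite [z + _]addrC addrK normrZ u1 mulr1 gtr0_norm// ler_norml => /andP[h1 _].
    by rewrite /q ler_pdivlMr// [z + _]addrC; lra.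
  (* The slope excess at [a] and the two replacements of [v] by [u] each cost at most [2 t / 8], in
     total less than [t]. *)
  have e80 : 0 < 8^-1 :> R by rewrite invr_gt0.
  have [_ [a /= /andP[a0 a1] <-] qa] := inf_adherent e80 Sinf.
  set l := inf S in qa.
  pose d := (8 * (L + 1))^-1; have d0 : 0 < d by rewrite invr_gt0 mulr_gt0//; lra.
  have Ld : L * d <= 8^-1 by rewrite /d invfM mulrCA ler_piMr// ler_pdivrMr ?mul1r; lra.
  have d1 : d <= 1 by rewrite invf_le1 ?mulr_gt0//; lra.
  (* Then [2 t < a], so the quotient at [2 t] is at most [q a], while the one at [t] is at least
     [l]. *)
  exists (ball u d, [set t | 0 < t < a / 2]) => /=.
    split; first exact: nbhsx_ballx.
    near=> t; apply/andP; split; near: t; first exact: nbhs_right_gt.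
    by apply: nbhs_right_lt; rewrite divr_gt0.
  move=> [v t] /= [uv /andP[t0 ta]]; rewrite -ball_normE /= in uv.
  have v2 : `|v| <= 2.
    have := ler_normD (v - u) u; rewrite subrK u1 distrC; lra.
  have u2 : `|u| <= 2 by rewrite u1 ler1n.
  have t1 : t <= 1 by lra.
  have t21 : 2 * t <= 1 by lra.
  have t20 : 0 <= 2 * t by lra.
  have lip s : 0 <= s -> s <= 1 -> `|h (z + s *: v) - h (z + s *: u)| <= s * 8^-1.
    move=> s0 s1; rewrite (le_trans (hL _ _ (zu _ _ s0 s1 v2) (zu _ _ s0 s1 u2)))//.
    rewrite opprD addrACA subrr add0r -scalerBr normrZ ger0_norm//.
    rewrite mulrCA ler_wpM2l// distrC.
    by have := ler_wpM2l L0 (ltW uv); lra.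
  have lt : l * t <= h (z + t *: u) - h z.
    rewrite -ler_pdivlMr//; apply: ge_inf; first by case: Sinf.
    by exists t => //=; rewrite t0.
  have ut : h (z + (2 * t) *: u) - h z <= 2 * t * q a.
    have s0 : 0 <= 2 * t / a by rewrite divr_ge0// ltW.
    have s1 : 2 * t / a <= 1 by rewrite ler_pdivrMr//; lra.
    have : h ((2 * t / a) *: (z + a *: u) + (1 - 2 * t / a) *: z) <=
        2 * t / a * h (z + a *: u) + (1 - 2 * t / a) * h z by exact: ch.
    have -> : (2 * t / a) *: (z + a *: u) + (1 - 2 * t / a) *: z = z + (2 * t) *: u.
      rewrite scalerDr scalerA divfK ?gt_eqF// scalerBl scale1r.
      by rewrite addrAC [_ + (z - _)]addrC subrK.
    have -> : 2 * t * q a = 2 * t / a * (h (z + a *: u) - h z) by rewrite /q; field; rewrite gt_eqF.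
    lra.
  have tq : t * q a < t * (l + 8^-1) by rewrite ltr_pM2l.
  have := lip _ t20 t21; have := lip _ (ltW t0) t1; rewrite !ler_norml /P.
  lra.
- move=> r /= r0 Pr; exists r => // p p0 pr.
  have := Pr `|p|; rewrite /= sub0r normrN normr_id => /(_ pr p0 (`|p|^-1 *: p)).
  rewrite /P /= normrZ normrV ?unitfE ?gt_eqF// normr_id mulVf ?gt_eqF// => /(_ erefl).
  by rewrite !scalerA -mulrA mulfV ?gt_eqF// mulr1 scale1r.
Unshelve. all: by end_near. Qed.

Lemma eucl_continuous z : continuous (fun x : R * R => eucl (x - z)).
Proof.
move=> x; apply/cvgrPdist_le => e e0.
have /filterS : nbhs x (ball x (e / 2)) by apply: nbhsx_ballx; rewrite divr_gt0.
apply => y; rewrite -ball_normE/= => xy.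
have := eucl_leD (x - y) (y - z); have := eucl_leD (y - x) (x - z).
rewrite !addrA !subrK (euclB y x) ler_norml; have := eucl_le_norm (x - y); lra.
Qed.

(* A relatively clopen piece of [M] near [z] that misses [z] has a point [p] nearest to [z];
   there the distance function has slope [-1] along the segment from [z] to [p], which the
   estimate on the second difference excludes. *)
Lemma DC2_distA_locally_connected (M : set (R * R)) z : closed M -> DC2 (distA M) -> M z ->
  \forall m \near z, M m -> connected_component M z m.
Proof.
move=> cM [g [h [cg [ch dM]]]] Mz.
have [r r0 hr] := convex2_second_difference h z ch.
pose X := M `&` [set x | `|x - z| <= r / 2].
have XM : X `<=` M by move=> x [].
have clX : closed X.
  apply: closedI => //.
  have : closed ((fun x : R * R => `|x - z|) @^-1` [set t : R | t <= r / 2]).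
    apply: preimage_closed; last exact: closed_le.
    by move=> x _; apply: cvg_norm; apply: cvgB; [exact: cvg_id|exact: cvg_cst].
  by [].
have kX : compact X.
  apply: subclosed_compact clX (ball_compact (`|z| + r / 2)) _ => x [_ /= xz].
  by have := ler_normD (x - z) z; rewrite subrK; lra.
apply/nbhs_ballP; exists (r / 4); first by rewrite /= divr_gt0.
move=> m; rewrite -ball_normE/= => zm Mm.
apply: connected_component_sym.
suff : connected_component X m z.
  by move=> [B [Bm BX cB] Bz]; exists B => //; split => // x /BX[].
have mz : eucl (m - z) < r / 2 by have := eucl_le_norm (m - z); rewrite distrC; lra.
apply: connected_component_clopen => //.
  by split => //=; rewrite distrC; lra.
move=> A AX cA cXA Am; apply: contrapT => Az.
have kA : compact A by exact: subclosed_compact cA kX AX.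
have [p] : exists2 c, c \in A & forall t, t \in A -> eucl (c - z) <= eucl (t - z).
  apply: compact_EVT_min => //; first by exists m.
  by apply: continuous_subspaceT; exact: eucl_continuous.
rewrite inE => Ap pmin; pose e := eucl (p - z).
have {}pmin a : A a -> e <= eucl (a - z) by move=> Aa; apply: pmin; rewrite inE.
have er : e < r / 2 by exact: le_lt_trans (pmin m Am) mz.
have pz : 0 < `|p - z|.
  by rewrite normr_gt0 subr_eq0; apply/eqP => pz; apply: Az; rewrite -pz.
have e0 : 0 < e by exact: lt_le_trans pz (norm_le_eucl _).
(* As [p] is strictly inside the ball defining [X], relative openness of [A] in [X] gives relative
   openness in [M] at [p]. *)
have [n n0 nA] : exists2 n : R, 0 < n & forall a, M a -> eucl (p - a) < n -> A a.
  have /nbhs_ballP[n /= n0 nXA] : nbhs p (~` (X `\` A)).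
    by apply: open_nbhs_nbhs; split; [exact: closed_openC|case].
  exists (Num.min n (r / 2 - e)); first by rewrite lt_min n0 subr_gt0.
  move=> a Ma; rewrite lt_min => /andP[pn pr]; apply: contrapT => NAa.
  apply: (nXA a); first by rewrite -ball_normE/= (le_lt_trans (norm_le_eucl _)).
  split => //; split => //=.
  have := norm_le_eucl (a - z); have := eucl_leD (a - p) (p - z).
  by rewrite addrA subrK (euclB a p) -/e; lra.
pose t := Num.min 2^-1 (n / (2 * e)).
have t0 : 0 < t by rewrite lt_min invr_gt0 ltr0n divr_gt0// mulr_gt0.
have t1 : t <= 2^-1 by rewrite ge_min lexx.
have te : 2 * (t * e) <= n.
  have : t <= n / (2 * e) by rewrite ge_min lexx orbT.
  by rewrite ler_pdivlMr ?mulr_gt0//; lra.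
pose w := p - z; pose q := z + (1 - t) *: w.
have pq : eucl (p - q) = t * e.
  have -> : p - q = t *: w.
    by rewrite /q scalerBl scale1r opprD addrA -/w opprB addrCA subrr addr0.
  by rewrite eucl_scale gtr0_norm.
have qz : eucl (q - z) = (1 - t) * e.
  by rewrite /q addrAC subrr add0r eucl_scale ger0_norm//; lra.
(* A point of [M] closer to [q] than [t e] is within [n] of [p], hence in [A], and then closer to
   [z] than [p]. *)
have dq : t * e <= distA M q.
  apply: distA_ge; first by exists z.
  move=> a Ma; rewrite leNgt; apply/negP => qa.
  have Aa : A a.
    apply: nA => //; have := eucl_leD (p - q) (q - a).
    by rewrite addrA subrK pq; lra.
  have := pmin a Aa; have := eucl_leD (a - q) (q - z).
  by rewrite addrA subrK (euclB a q) qz; lra.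
have Mp : M p by have [] := AX p Ap.
have dp := distA_mem M p Mp; have dz := distA_mem M z Mz.
rewrite dM in dp; rewrite dM in dz; rewrite dM in dq.
have hw : h (z + 2 *: w) - 2 * h (z + w) + h z < `|w|.
  by apply: hr => //; have := norm_le_eucl w; rewrite /w -/e; lra.
have zw : z + w = p by rewrite addrC subrK.
have gq : g q <= (1 - t) * g p + t * g z.
  have h1 : 0 <= 1 - t by lra.
  have h2 : 1 - t <= 1 by lra.
  have : g ((1 - t) *: p + (1 - (1 - t)) *: z) <= (1 - t) * g p + (1 - (1 - t)) * g z.
    exact: cg.
  have -> : (1 - t) *: p + (1 - (1 - t)) *: z = q.
    rewrite /q -zw; congr pair => /=; rewrite /GRing.scale/=; ring.
  by rewrite subKr.
(* The point [p = z + w] divides the segment from [q] to [z + 2 w] with weights proportional to 1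
   and [t]. *)
have hp : (1 + t) * h p <= h q + t * h (z + 2 *: w).
  have s0 : 0 <= (1 + t)^-1 by rewrite invr_ge0; lra.
  have s1 : (1 + t)^-1 <= 1 by rewrite invf_le1; lra.
  have tN0 : 1 + t != 0 by rewrite gt_eqF//; lra.
  have : h ((1 + t)^-1 *: q + (1 - (1 + t)^-1) *: (z + 2 *: w)) <=
      (1 + t)^-1 * h q + (1 - (1 + t)^-1) * h (z + 2 *: w) by exact: ch.
  have -> : 1 - (1 + t)^-1 = (1 + t)^-1 * t by field.
  have -> : (1 + t)^-1 *: q + ((1 + t)^-1 * t) *: (z + 2 *: w) = p.
    rewrite -zw /q [z + w]surjective_pairing; congr pair => /=; rewrite /GRing.scale/=; field.
      by [].
    by [].
  rewrite -mulrA -mulrDr mulrC ler_pdivlMr; last by lra.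
  by rewrite mulrC.
have twe : t * `|w| <= t * e by rewrite ler_pM2l//; exact: norm_le_eucl.
have {}hw : t * (h (z + 2 *: w) - 2 * h p + h z) < t * `|w| by rewrite ltr_pM2l// -zw.
(* With [g = h] at [p] and [z], the bounds give [t e <= g q - h q < t |w| <= t e]. *)
have gp : g p = h p by lra.
have gz : g z = h z by lra.
rewrite gp gz in gq; lra.
Qed.

End isolation.

(** * The equivalence *)

Theorem theorem4p20 (R : realType) (M : set (R * R)) :
  closed M -> M !=set0 ->
  (inD2 M <-> ((forall C, component_of M C -> inD2 C) /\ discrete_system (component_of M))).
Proof.
move=> cM M0; split.
  move=> [M_eq0|[_ [_ DCM]]]; first by move: M0; rewrite M_eq0 => -[].
  have near_component z : M z -> \forall m \near z, M m -> connected_component M z m.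
    exact: DC2_distA_locally_connected.
  split.
    move=> _ [x Mx ->]; right; have cC := @component_closed _ M x cM.
    have C0 : connected_component M x !=set0.
      by exists x; exact: connected_component_refl.
    (* Near each of its points the component coincides with [M], whose distance function is DC. *)
    split=> //; split=> //; apply: DC2_distA_local => // z Cz.
    have Mz : M z by exact: connected_component_sub Cz.
    exists M; split=> //; apply: filterS (near_component z Mz) => y zy; split.
      exact: connected_component_sub.
    by move=> /zy; exact: connected_component_trans.
  move=> z; have [Mz|Mz] := pselect (M z).
    exists [set m | M m -> connected_component M z m]; split; first exact: near_component.
    suff E C : component_of M C ->
        [set m | M m -> connected_component M z m] `&` C !=set0 -> C = connected_component M z.
      by move=> C1 C2 SC1 SC2 /(E _ SC1) -> /(E _ SC2) ->.
    move=> [x Mx ->] [y [/= zy xy]].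
    have My : M y by exact: connected_component_sub xy.
    by rewrite (same_connected_component xy) (same_connected_component (zy My)).
  exists (~` M); split; first by apply: open_nbhs_nbhs; split => //; exact: closed_openC.
  by move=> C1 C2 [x Mx ->] _ [y [My /connected_component_sub]].
move=> [DC_components discr]; right; split=> //; split=> //.
apply: DC2_distA_local => // z Mz; exists (connected_component M z); split.
- exact: connected_component_refl.
(* The empty alternative of [inD2] is excluded because the component contains [z]. *)
- have /DC_components[C0|[_ []//]] : component_of M (connected_component M z) by exists z.
  by have := connected_component_refl Mz; rewrite C0.
(* Discreteness makes [M] coincide with the component of [z] on [U]. *)
- have [U [Uz UC]] := discr z; have Uzz := nbhs_singleton Uz.
  apply: filterS Uz => y Uy; split; last exact: connected_component_sub.
  move=> My; have -> : connected_component M z = connected_component M y.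
    apply: UC.
    - by exists z.
    - by exists y.
    - by exists z; split; [exact: Uzz|exact: connected_component_refl].
    - by exists y; split => //; exact: connected_component_refl.
  exact: connected_component_refl.
Qed.
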